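(* Let $m\ge1$ be an integer and $\tau>0$ a time step, with the discretization matrices and discrete inner product defined in the context. The scheme $$\frac{\mathbf{u}^{n+1}-\mathbf{u}^n}{\tau}=\mathbf{P}^{-1}\mathbf{F}^{-1}\mathbf{S}_1\mathbf{F}\mathbf{P}\Big[\mathbf{P}^{-1}\mathbf{F}^{-1}\mathbf{H}\mathbf{S}_1\mathbf{F}\mathbf{P}\,\mathbf{u}^{n+\frac12}-\frac{2}{m(m+1)}\,\mathrm{diag}\Big(\frac{(\mathbf{u}^{n+1})^{\mathbf{m+1}}-(\mathbf{u}^{n})^{\mathbf{m+1}}}{(\mathbf{u}^{n+1})^{\mathbf{2}}-(\mathbf{u}^{n})^{\mathbf{2}}}\Big)\mathbf{u}^{n+\frac12}\Big],$$ where $\mathbf u^{n+\frac12}=\frac12(\mathbf u^n+\mathbf u^{n+1})$, conserves the discrete energy $$E_h^n=\tfrac12\langle\mathbf P^{-1}\mathbf F^{-1}\mathbf H\mathbf S_1\mathbf F\mathbf P\,\mathbf u^n,\mathbf u^n\rangle_h-\tfrac1{m(m+1)}\langle(\mathbf u^n)^{\mathbf m},\mathbf u^n\rangle_h$$ exactly in time: if real grid vectors $\mathbf u^n,\mathbf u^{n+1}$ satisfy the scheme, then $$E_h^{n+1}=E_h^n.$$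
   Context: The scheme discretizes the generalized Benjamin-Ono equation $u_t=-(-\mathcal H u_x+\frac1m u^m)_x$ on $\mathbb R$, $u$ real-valued, $\mathcal H$ the Hilbert transform; $\mathbf u^n$ approximates $u(x_j,n\tau)$. Discretization. Let $\alpha>0$, $N$ a positive even integer, $J=\{-N/2,\dots,N/2-1\}$; vectors and matrices are indexed by $J$. Put $\theta_j=2\pi j/N$, $x_j=\alpha\tan(\theta_j/2)$, so $x_{-N/2}=-\infty$. Define: - $\mathbf F_{kj}=\frac1N e^{-ik\theta_j}$ and $(\mathbf F^{-1})_{jk}=e^{ik\theta_j}$ (discrete Fourier matrix and its inverse); - $\mathbf P=\mathrm{diag}(\alpha-ix_j)_{j\in J}$ and $\mathbf W=\mathbf P\overline{\mathbf P}=\mathrm{diag}(w_j)$, $w_j=\alpha^2+x_j^2$; - $\mathbf S_1$ the tridiagonal matrix $(\mathbf S_1\hat{\mathbf u})_k=\frac{i}{2\alpha}\big[k\hat u_{k-1}+(2k+1)\hat u_k+(k+1)\hat u_{k+1}\big]$, where $\hat u_{k}:=0$ for $k\notin J$; - $\mathbf H=-i\,\mathrm{diag}(\mathrm{sgn}(k+\tfrac12))_{k\in J}$. Boundary convention at the node $x_{-N/2}=-\infty$: all grid vectors $\mathbf u=(u_j)_{j\in J}$ satisfy $u_{-N/2}=0$, and this node contributes nothing; i.e. the $-N/2$ diagonal entries of $\mathbf P$, $\mathbf P^{-1}$ and $\mathbf W$ are read as $0$ (the other diagonal entries of $\mathbf P^{-1}$ are $1/(\alpha-ix_j)$). The discrete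 inner product is $\langle\mathbf u,\mathbf v\rangle_h=\frac{\pi}{N\alpha}\overline{\mathbf v}^T\mathbf W\mathbf u=\frac{\pi}{N\alpha}\sum_{j\in J} w_ju_j\bar v_j$. Powers $\mathbf u^{\mathbf p}=(u_j^p)_j$ and quotients of vectors are entrywise, and $\mathrm{diag}(\mathbf v)$ is the diagonal matrix with diagonal $\mathbf v$. Convention for vanishing denominators: for real $a,b$ the scalar expression $\frac{a^{m+1}-b^{m+1}}{a^2-b^2}\cdot\frac{a+b}{2}$, which occurs entrywise in the nonlinear term with $a=u_j^{n+1}$, $b=u_j^n$, is understood as its polynomial (continuous) extension $\frac12\sum_{k=0}^m a^kb^{m-k}$ when $a^2=b^2$. *)

(* Defs.v *)
From HB Require Import structures.
From mathcomp Require Import all_boot all_order all_algebra.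
From mathcomp Require Import all_reals trigo.
From mathcomp Require Import complex.

Set Implicit Arguments.
Unset Strict Implicit.
Unset Printing Implicit Defensive.

Import Order.TTheory GRing.Theory Num.Theory.
Local Open Scope ring_scope.
Local Open Scope complex_scope.

(* J = {-N/2, ..., N/2 - 1} is represented by 'I_N, the ordinal j standing for
   the integer index j - N/2.  The boundary index -N/2 is the ordinal 0. *)
Definition idx (N : nat) (j : 'I_N) : int := (j : nat)%:Z - (N./2)%:Z.

Definition bdry (N : nat) (j : 'I_N) : bool := (j : nat) == 0%N.

Definition theta (R : realType) (N : nat) (j : 'I_N) : R :=
  2%:R * pi * (idx j)%:~R / N%:R.

(* At the boundary index the value is a junk value (tan is total) standing for
   -oo; Pmx, Pinvmx and Wmx do not use it. *)
Definition node (R : realType) (alpha : R) (N : nat) (j : 'I_N) : R :=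
  alpha * tan (theta R j / 2%:R).

Definition cis (R : realType) (t : R) : R[i] := cos t +i* sin t.

Definition Fmx (R : realType) (N : nat) : 'M[R[i]]_N :=
  \matrix_(k, j) ((N%:R)^-1 * cis (- ((idx k)%:~R * theta R j))).

Definition Finvmx (R : realType) (N : nat) : 'M[R[i]]_N :=
  \matrix_(j, k) cis ((idx k)%:~R * theta R j).

Definition Pmx (R : realType) (alpha : R) (N : nat) : 'M[R[i]]_N :=
  diag_mx (\row_j if bdry j then 0 else alpha -i* node alpha j).

Definition Pinvmx (R : realType) (alpha : R) (N : nat) : 'M[R[i]]_N :=
  diag_mx (\row_j if bdry j then 0 else (alpha -i* node alpha j)^-1).

Definition Wmx (R : realType) (alpha : R) (N : nat) : 'M[R[i]]_N :=
  diag_mx (\row_j if bdry j then 0 else (alpha ^+ 2 + node alpha j ^+ 2)%:C).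

Lemma Wmx_PPbar (R : realType) (alpha : R) (N : nat) :
  Wmx alpha N = Pmx alpha N *m map_mx (@conjc R) (Pmx alpha N).
Proof.
rewrite /Wmx /Pmx map_diag_mx mulmx_diag; congr diag_mx; apply/rowP => j.
rewrite !mxE; case: ifP => _; first by rewrite mul0r.
apply/eqP; rewrite eq_complex /=; apply/andP; split; apply/eqP.
  by rewrite opprK mulNr opprK !expr2.
by rewrite opprK mulNr [node _ _ * _]mulrC subrr.
Qed.

Definition S1mx (R : realType) (alpha : R) (N : nat) : 'M[R[i]]_N :=
  \matrix_(k, l) ((0 +i* 1 : R[i]) / (2%:R * alpha)%:C *
    (if idx l == idx k - 1 then (idx k)%:~R
     else if idx l == idx k then (2 * idx k + 1)%:~R
     else if idx l == idx k + 1 then (idx k + 1)%:~R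
     else 0)).

Definition Hmx (R : realType) (N : nat) : 'M[R[i]]_N :=
  (0 -i* 1 : R[i]) *: diag_mx (\row_k (Num.sg ((idx k)%:~R + 2%:R^-1 : R))%:C).

Definition grid_vector (R : realType) (N : nat) (u : 'cV[R]_N) : Prop :=
  forall j : 'I_N, bdry j -> u j 0 = 0.

Definition toC (R : realType) (N : nat) (u : 'cV[R]_N) : 'cV[R[i]]_N :=
  map_mx (real_complex R) u.

Definition powv (R : realType) (N : nat) (u : 'cV[R]_N) (p : nat) : 'cV[R]_N :=
  map_mx (fun x => x ^+ p) u.

Definition ip_h (R : realType) (alpha : R) (N : nat) (u v : 'cV[R[i]]_N) : R[i] :=
  (pi / (N%:R * alpha))%:C *
  ((map_mx (@conjc R) v)^T *m Wmx alpha N *m u) 0 0.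

(* P^-1 F^-1 S_1 F P *)
Definition Dmx (R : realType) (alpha : R) (N : nat) : 'M[R[i]]_N :=
  Pinvmx alpha N *m Finvmx R N *m S1mx alpha N *m Fmx R N *m Pmx alpha N.

(* P^-1 F^-1 H S_1 F P *)
Definition HDmx (R : realType) (alpha : R) (N : nat) : 'M[R[i]]_N :=
  Pinvmx alpha N *m Finvmx R N *m Hmx R N *m S1mx alpha N *m Fmx R N
    *m Pmx alpha N.

Definition midv (R : realType) (N : nat) (u0 u1 : 'cV[R]_N) : 'cV[R]_N :=
  2%:R^-1 *: (u0 + u1).

(* (a^(m+1) - b^(m+1)) / (a^2 - b^2) * (a + b) / 2, replaced by its polynomial
   extension when a^2 = b^2. *)
Definition quot_mid (R : realType) (m : nat) (a b : R) : R :=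
  if a ^+ 2 == b ^+ 2 then 2%:R^-1 * \sum_(k < m.+1) a ^+ k * b ^+ (m - k)
  else (a ^+ m.+1 - b ^+ m.+1) / (a ^+ 2 - b ^+ 2) * ((a + b) / 2%:R).

(* diag((u1^(m+1) - u0^(m+1)) / (u1^2 - u0^2)) applied to midv u0 u1.  The
   product is taken entrywise because the convention for a vanishing
   denominator concerns the product with (a + b) / 2, not the quotient alone. *)
Definition nonlin (R : realType) (N m : nat) (u0 u1 : 'cV[R]_N) : 'cV[R]_N :=
  \col_j quot_mid m (u1 j 0) (u0 j 0).

Definition scheme_step (R : realType) (alpha tau : R) (N m : nat)
    (u0 u1 : 'cV[R]_N) : Prop :=
  toC (tau^-1 *: (u1 - u0)) =
  Dmx alpha N *m
    (HDmx alpha N *m toC (midv u0 u1)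
     - (2%:R / (m * m.+1)%:R) *: toC (nonlin m u0 u1)).

(* Complex-valued, as the discrete inner product is. *)
Definition energy_h (R : realType) (alpha : R) (N m : nat) (u : 'cV[R]_N) : R[i] :=
  2%:R^-1 * ip_h alpha (HDmx alpha N *m toC u) (toC u)
  - ((m * m.+1)%:R)^-1 * ip_h alpha (toC (powv u m)) (toC u).

(* Main.v *)
Require Import Defs.
From mathcomp Require Import all_boot all_order all_algebra.
From mathcomp Require Import all_reals trigo complex ring lra zify.

(** The scheme is a skew-symmetric operator applied to a discrete gradient of
    the energy, and such a scheme preserves the energy.

    Put D = P^-1 F^-1 S_1 F P and A = P^-1 F^-1 H S_1 F P.  With respect to the
    weighted product <.,.>_h, D is skew-adjoint and A is self-adjoint
    ([adjmx_WD], [adjmx_WHD]).  Both follow from one computation: W P^-1 is the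
    conjugate of P and F^-1 is N times the adjoint of F, so that
    W P^-1 F^-1 M F P = N (F P)^* M (F P) for every M ([Wmx_conj]).  Hence
    only M = S_1 and M = H S_1 have to be examined.  The matrix S_1 is i times
    a real symmetric tridiagonal matrix, hence skew-Hermitian.  The multiplier
    H preserves this symmetry up to the factor i because it jumps only between
    the modes -1 and 0, and the coefficient coupling these two modes vanishes;
    so H S_1 is real symmetric.

    Let d = u1 - u0 and let g be the bracket of the scheme, so that
    d = tau D g.  The bracket is a discrete gradient: E(u1) - E(u0) is the real
    part of <g, d>_h ([energy_h_increment]).  For the quadratic part this is
    the polarisation identity for A at the midpoint ([ip_h_HD_midv]).  For the
    nonlinear part it is the factorisation by which the quotient of the scheme,
    multiplied by u1 - u0, becomes half of u1^(m+1) - u0^(m+1)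
    ([ip_h_nonlin]).  Finally <g, D g>_h is purely imaginary because D is
    skew-adjoint, so the increment is zero.

    The real part has to be taken, and is written below as half of
    <g, d> + <d, g>: A maps real vectors to complex ones, so <g, d> itself is
    not the increment of the energy in general. *)

Set Implicit Arguments.
Unset Strict Implicit.
Unset Printing Implicit Defensive.

Import Order.TTheory GRing.Theory Num.Theory.
Local Open Scope ring_scope.
Local Open Scope complex_scope.

(** * Conjugate transposes *)

Lemma conjcM (R : rcfType) (x y : R[i]) : (x * y)^*%C = x^*%C * y^*%C.
Proof. exact: rmorphM. Qed.

Definition adjmx (R : rcfType) (p q : nat) (A : 'M[R[i]]_(p, q)) :
    'M[R[i]]_(q, p) :=
  (map_mx (@conjc R) A)^T.

Lemma adjmxK (R : rcfType) p q (A : 'M[R[i]]_(p, q)) : adjmx (adjmx A) = A.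
Proof. by apply/matrixP=> i j; rewrite !mxE conjcK. Qed.

Lemma adjmxM (R : rcfType) p q r (A : 'M[R[i]]_(p, q)) (B : 'M[R[i]]_(q, r)) :
  adjmx (A *m B) = adjmx B *m adjmx A.
Proof. by rewrite /adjmx map_mxM trmx_mul. Qed.

Lemma adjmx_natZ (R : rcfType) p q n (A : 'M[R[i]]_(p, q)) :
  adjmx (n%:R *: A) = n%:R *: adjmx A.
Proof. by apply/matrixP=> i j; rewrite !mxE rmorphM rmorph_nat. Qed.

(** * Symmetry of the two spectral operators *)

Section Discretization.

Variables (R : realType) (alpha : R) (N : nat).

Lemma cisN (t : R) : cis (- t) = (cis t)^*%C.
Proof. by rewrite /cis cosN sinN. Qed.

Lemma Finvmx_adj : (0 < N)%N -> Finvmx R N = N%:R *: adjmx (Fmx R N).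
Proof.
move=> N0; apply/matrixP=> j k; rewrite !mxE rmorphM fmorphV rmorph_nat.
rewrite /= -[X in _ = _ * (_ * X)]cisN.
by rewrite opprK mulrA mulfV ?mul1r // pnatr_eq0 -lt0n.
Qed.

Lemma adjmx_Wmx : adjmx (Wmx alpha N) = Wmx alpha N.
Proof.
rewrite /adjmx map_diag_mx tr_diag_mx; congr diag_mx; apply/rowP=> j.
by rewrite !mxE; case: ifP; rewrite ?rmorph0 //= oppr0.
Qed.

(** At the boundary node both sides are zero; elsewhere the positivity of
    [alpha] makes the entry of P nonzero, and it cancels in W = P conj(P). *)
Lemma Wmx_Pinvmx :
  0 < alpha -> Wmx alpha N *m Pinvmx alpha N = adjmx (Pmx alpha N).
Proof.
move=> a0; rewrite Wmx_PPbar /adjmx /Pmx map_diag_mx tr_diag_mx !mulmx_diag.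
congr diag_mx; apply/rowP=> j; rewrite !mxE; case: ifP => _.
  by rewrite !mul0r rmorph0.
rewrite mulrAC mulfV ?mul1r //.
by rewrite eq_complex /= negb_and gt_eqF.
Qed.

(** The real factor of S_1, indexed by the integer modes themselves: symmetry in
    [k] and [l] then amounts to integer arithmetic. *)
Definition S1coef (k l : int) : int :=
  if l == k - 1 then k else if l == k then 2 * k + 1
  else if l == k + 1 then k + 1 else 0.

Lemma S1mxE k l :
  S1mx alpha N k l =
  'i%C * ((2%:R * alpha)^-1 * (S1coef (idx k) (idx l))%:~R)%:C.
Proof.
rewrite mxE [X in _ = _ * X]rmorphM fmorphV rmorph_int -mulrA /S1coef.
by do 3?case: ifP => // _.
Qed.

Lemma S1coef_sym k l : S1coef k l = S1coef l k.
Proof. rewrite /S1coef; repeat case: ifP; lia. Qed.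

Definition hsgn (k : int) : R := Num.sg (k%:~R + 2%:R^-1).

Lemma hsgn_ge0 k : 0 <= k -> hsgn k = 1.
Proof.
move=> k0; rewrite /hsgn gtr0_sg //.
have : (0 : R) <= k%:~R by rewrite ler0z.
lra.
Qed.

Lemma hsgn_lt0 k : k < 0 -> hsgn k = -1.
Proof.
move=> k0; rewrite /hsgn ltr0_sg //.
have : k%:~R <= (-1)%:~R :> R by rewrite ler_int; lia.
rewrite rmorphN1; lra.
Qed.

(** The sign changes only from mode -1 to mode 0, where the coupling coefficient
    [k + 1] is zero.  This is why H, although diagonal and not scalar, commutes
    with S_1. *)
Lemma hsgn_S1coef k l : S1coef k l != 0 -> hsgn k = hsgn l.
Proof.
have [k0|k0] := leP 0 k; have [l0|l0] := leP 0 l;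
  rewrite ?(hsgn_ge0 k0) ?(hsgn_lt0 k0) ?(hsgn_ge0 l0) ?(hsgn_lt0 l0) //;
  rewrite /S1coef; repeat case: ifP; lia.
Qed.

Lemma adjmx_S1mx : adjmx (S1mx alpha N) = - S1mx alpha N.
Proof.
apply/matrixP=> k l; rewrite [LHS]mxE [LHS]mxE [RHS]mxE !S1mxE S1coef_sym.
by rewrite conjcM conjc_real -mulNr /= -[- 'i%C]/(- 0 -i* 1) oppr0.
Qed.

(** The factor -i of H cancels the factor i of S_1, so the product is real. *)
Lemma HS1mxE k l :
  (Hmx R N *m S1mx alpha N) k l =
  (hsgn (idx k) * ((2%:R * alpha)^-1 * (S1coef (idx k) (idx l))%:~R))%:C.
Proof.
have mNii : (0 -i* 1) * 'i%C = 1 :> R[i].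
  apply/eqP; rewrite eq_complex /= !mul0r !mulr0 mulr1 sub0r opprK addr0.
  by rewrite !eqxx.
rewrite /Hmx -scalemxAl mul_diag_mx mxE [X in _ * X]mxE S1mxE !mxE -/(hsgn _).
by rewrite [RHS]rmorphM mulrCA [X in _ * X]mulrA mNii mul1r.
Qed.

Lemma adjmx_HS1mx : adjmx (Hmx R N *m S1mx alpha N) = Hmx R N *m S1mx alpha N.
Proof.
apply/matrixP=> k l; rewrite [LHS]mxE [LHS]mxE !HS1mxE conjc_real; congr _%:C.
rewrite [S1coef (idx l) _]S1coef_sym.
have [->|/hsgn_S1coef->//] := eqVneq (S1coef (idx k) (idx l)) 0.
by rewrite !mulr0.
Qed.

(** Multiplying by the weight turns the similarity by F P into a congruence,
    which preserves Hermitian and skew-Hermitian matrices. *)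
Lemma Wmx_conj (M : 'M[R[i]]_N) : 0 < alpha -> (0 < N)%N ->
  Wmx alpha N *m (Pinvmx alpha N *m Finvmx R N *m M *m Fmx R N *m Pmx alpha N)
  = N%:R *: (adjmx (Fmx R N *m Pmx alpha N) *m M *m (Fmx R N *m Pmx alpha N)).
Proof.
move=> a0 N0; rewrite !mulmxA Wmx_Pinvmx // Finvmx_adj // adjmxM.
by rewrite -scalemxAr -!scalemxAl.
Qed.

Lemma adjmx_WD : 0 < alpha -> (0 < N)%N ->
  adjmx (Wmx alpha N *m Dmx alpha N) = Wmx alpha N *m (- Dmx alpha N).
Proof.
move=> a0 N0; rewrite mulmxN /Dmx Wmx_conj //.
by rewrite adjmx_natZ !adjmxM !adjmxK adjmx_S1mx mulNmx mulmxN scalerN !mulmxA.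
Qed.

Lemma adjmx_WHD : 0 < alpha -> (0 < N)%N ->
  adjmx (Wmx alpha N *m HDmx alpha N) = Wmx alpha N *m HDmx alpha N.
Proof.
move=> a0 N0; rewrite /HDmx -(mulmxA _ (Hmx R N)) Wmx_conj //.
rewrite adjmx_natZ adjmxM [adjmx (adjmx _ *m _)]adjmxM adjmxK adjmx_HS1mx.
by rewrite !mulmxA.
Qed.

(** * The discrete inner product *)

Local Notation "<< u , v >>" := (ip_h alpha u v).
Implicit Types u v : 'cV[R[i]]_N.

Lemma ip_hDl u u' v : <<u + u', v>> = <<u, v>> + <<u', v>>.
Proof. by rewrite /ip_h mulmxDr mxE mulrDr. Qed.

Lemma ip_hZl a u v : <<a *: u, v>> = a * <<u, v>>.
Proof. by rewrite /ip_h -scalemxAr mxE mulrCA. Qed.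

Lemma ip_hDr u v v' : <<u, v + v'>> = <<u, v>> + <<u, v'>>.
Proof. by rewrite /ip_h map_mxD linearD /= !mulmxDl mxE mulrDr. Qed.

Lemma ip_hZr a u v : <<u, a *: v>> = a^*%C * <<u, v>>.
Proof. by rewrite /ip_h map_mxZ linearZ /= -!scalemxAl mxE mulrCA. Qed.

Lemma ip_hNl u v : <<- u, v>> = - <<u, v>>.
Proof. by rewrite -scaleN1r ip_hZl mulN1r. Qed.

Lemma ip_hNr u v : <<u, - v>> = - <<u, v>>.
Proof. by rewrite -scaleN1r ip_hZr rmorphN1 mulN1r. Qed.

(** [ip_h] is conjugate-linear in its second argument, so moving a matrix across
    it only involves the conjugate transpose of its product with the weight. *)
Lemma ip_h_adjoint (A B : 'M[R[i]]_N) u v :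
  adjmx (Wmx alpha N *m A) = Wmx alpha N *m B ->
  <<B *m u, v>> = <<u, A *m v>>.
Proof.
rewrite adjmxM adjmx_Wmx => AB.
rewrite /ip_h -!/(adjmx _) adjmxM -(mulmxA _ (adjmx A)) AB.
by rewrite !mulmxA.
Qed.

(** The pairing of two real vectors is real.  Hence the nonlinear terms, unlike
    those in A, need no symmetrisation. *)
Lemma ip_h_toC (f g : 'cV[R]_N) :
  <<toC f, toC g>> =
  (pi / (N%:R * alpha) *
   \sum_j (if bdry j then 0 else alpha ^+ 2 + node alpha j ^+ 2)
     * (f j 0 * g j 0))%:C.
Proof.
rewrite /ip_h [RHS]rmorphM [X in _ = _ * X]rmorph_sum /Wmx mul_mx_diag mxE.
congr (_ * _).
apply: eq_bigr => j _; rewrite !mxE conjc_real.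
rewrite [RHS]rmorphM [X in _ = _ * X]rmorphM.
rewrite -mulrA [LHS]mulrC -mulrA; congr (_ * _).
by case: ifP => _; rewrite ?rmorph0.
Qed.

Lemma ip_h_toCC (f g : 'cV[R]_N) : <<toC f, toC g>> = <<toC g, toC f>>.
Proof.
rewrite !ip_h_toC; congr (_ * _)%:C.
by apply: eq_bigr => j _; rewrite [f j 0 * _]mulrC.
Qed.

Lemma toCB (f g : 'cV[R]_N) : toC (f - g) = toC f - toC g.
Proof. by rewrite /toC map_mxB. Qed.

Lemma toCZ a (f : 'cV[R]_N) : toC (a *: f) = a%:C *: toC f.
Proof. by rewrite /toC map_mxZ. Qed.

End Discretization.

(** * The discrete gradient of the energy *)

(** The two branches of [quot_mid] obey the same identity, which is all that the
    energy balance sees: the convention for vanishing denominators is the one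
    that keeps it true. *)
Lemma quot_midP (R : realType) m (a b : R) :
  quot_mid m a b * (a - b) = 2%:R^-1 * (a ^+ m.+1 - b ^+ m.+1).
Proof.
rewrite /quot_mid; case: ifP => [_|/negbT].
  (* [subrXX] lists the monomials with the exponents in the reverse order. *)
  rewrite subrXX -mulrA; congr (_ * _); rewrite mulrC; congr (_ * _).
  rewrite (reindex_inj rev_ord_inj) /=; apply: eq_bigr => k _.
  by rewrite subSS subKn // -ltnS.
rewrite -subr_eq0 subr_sqr mulf_eq0 negb_or => /andP[ab0 ab1].
by field; rewrite ab0 ab1.
Qed.

Lemma ip_h_nonlin (R : realType) (alpha : R) N m (u0 u1 : 'cV[R]_N) :
  ip_h alpha (toC (nonlin m u0 u1)) (toC (u1 - u0)) =
  2%:R^-1 * (ip_h alpha (toC (powv u1 m)) (toC u1)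
             - ip_h alpha (toC (powv u0 m)) (toC u0)).
Proof.
rewrite !ip_h_toC -rmorphB -(rmorph_nat (real_complex R)) -fmorphV -rmorphM.
congr _%:C; rewrite -mulrBr mulrCA; congr (_ * _).
rewrite -sumrB mulr_sumr; apply: eq_bigr => j _.
by rewrite !mxE quot_midP -!exprSr mulrCA mulrBr.
Qed.

(** Polarisation at the midpoint.  The mixed terms of <A u1, u0> and <A u0, u1>
    need not be real, and cancel only because the two orders are added. *)
Lemma ip_h_HD_midv (R : realType) (alpha : R) N (u0 u1 : 'cV[R]_N) :
  0 < alpha -> (0 < N)%N ->
  let d := toC (u1 - u0) in let g := HDmx alpha N *m toC (midv u0 u1) in
  ip_h alpha g d + ip_h alpha d g =
  ip_h alpha (HDmx alpha N *m toC u1) (toC u1)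
  - ip_h alpha (HDmx alpha N *m toC u0) (toC u0).
Proof.
move=> a0 N0 d g; rewrite /d /g {d g}.
rewrite -(ip_h_adjoint _ _ (adjmx_WHD a0 N0)) toCB /midv toCZ.
rewrite -scalemxAr ip_hZl ip_hZr conjc_real fmorphV rmorph_nat.
rewrite /toC map_mxD !(mulmxDr, mulmxN) !(ip_hDl, ip_hDr, ip_hNl, ip_hNr).
by field.
Qed.

(** The bracket of the scheme is a discrete gradient of the energy: pairing it
    with an arbitrary increment [u1 - u0] gives the energy difference as a real
    part, whether or not the two vectors satisfy the scheme. *)
Lemma energy_h_increment (R : realType) (alpha : R) N m (u0 u1 : 'cV[R]_N) :
  0 < alpha -> (0 < N)%N ->
  let d := toC (u1 - u0) in
  let g := HDmx alpha N *m toC (midv u0 u1)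
           - (2%:R / (m * m.+1)%:R) *: toC (nonlin m u0 u1) in
  energy_h alpha m u1 - energy_h alpha m u0 =
  2%:R^-1 * (ip_h alpha g d + ip_h alpha d g).
Proof.
move=> a0 N0 d g; rewrite /energy_h /g.
rewrite ip_hDl ip_hDr ip_hNl ip_hNr ip_hZl ip_hZr addrACA ip_h_HD_midv //.
rewrite conjcM conjc_inv !conjc_nat [ip_h _ d _]ip_h_toCC ip_h_nonlin.
set k := (m * m.+1)%:R^-1.
by field.
Qed.

Theorem theorem3p2 (R : realType) (alpha tau : R) (N m : nat)
    (u0 u1 : 'cV[R]_N) :
  0 < alpha -> 0 < tau -> (0 < N)%N -> ~~ odd N -> (1 <= m)%N ->
  grid_vector u0 -> grid_vector u1 ->
  scheme_step alpha tau m u0 u1 ->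
  energy_h alpha m u1 = energy_h alpha m u0.
Proof.
move=> a0 t0 N0 _ _ _ _; rewrite /scheme_step toCZ.
set d := toC _; set g := _ - _ => dDg.
apply/eqP; rewrite -subr_eq0 energy_h_increment // -/d -/g mulf_eq0.
apply/orP; right.
(* After multiplication by tau^-1, both occurrences of d become D g. *)
have tau_neq0 : (tau^-1)%:C != 0 :> R[i] by rewrite fmorph_eq0 invr_eq0 gt_eqF.
rewrite -(mulrI_eq0 _ (mulfI tau_neq0)) mulrDr -{1}[_%:C]conjc_real.
rewrite -ip_hZr -ip_hZl dDg -(ip_h_adjoint _ _ (adjmx_WD a0 N0)).
by rewrite mulNmx ip_hNl addNr.
Qed.
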